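(* Let $\mathcal{A}$ be a family of admissible set objects (of one of the three types described in the context) with feasible domain $\mathcal{D}_\mathcal{A}$, and let $f_1,\dots,f_n:\mathcal{A}\to\mathbb{R}_{\ge0}$. Let $H:\mathbb{R}^n_{\ge0}\setminus\{\vec 0\}\to\mathbb{R}\cup\{+\infty\}$ be zero-homogeneous (i.e. $H(t\vec a)=H(\vec a)$ for $t>0$) with $H(\vec a+\vec b)\ge\min\{H(\vec a),H(\vec b)\}$ for all $\vec a,\vec b\in\mathbb{R}^n_{\ge0}\setminus\{\vec0\}$. Let $\mathrm{Dom}(H)=\{\vec a\in\mathbb{R}^n_{\ge0}\setminus\{\vec0\}:H(\vec a)\in\mathbb{R}\}$, $\mathcal{A}'=\{A\in\mathcal{A}:(f_1(A),\dots,f_n(A))\in\mathrm{Dom}(H)\}$ and $\mathcal{D}'=\{\vec x\in\mathcal{D}_\mathcal{A}\text{ with nonnegative entries}:(f_1^L(\vec x),\dots,f_n^L(\vec x))\in\mathrm{Dom}(H)\}$. Then $$\min_{A\in\mathcal{A}'}H(f_1(A),\dots,f_n(A))=\inf_{\vec x\in\mathcal{D}'}H(f_1^L(\vec x),\dots,f_n^L(\vec x)),$$ where $f_i^L$ denotes the multi-way Lovász extension of the corresponding type.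
   Context: $V=\{1,\dots,N\}$ is a finite set. Three types are allowed. (i) Original: $\mathcal{A}\subset\mathcal{P}(V)$, $V^t(\vec x)=\{i:x_i>t\}$, $f^L(\vec x)=\int_{\min_i x_i}^{\max_i x_i}f(V^t(\vec x))dt+f(V)\min_ix_i$, $\mathcal{D}_\mathcal{A}=\{\vec x\in\mathbb{R}^V_{\ge0}:V^t(\vec x)\in\mathcal{A}\ \forall t\in\mathbb{R}\}$. (ii) Disjoint-pair: $\mathcal{A}\subset\mathcal{P}_2(V)$ (ordered pairs of disjoint subsets), $V_\pm^t(\vec x)=\{i:\pm x_i>t\}$, $f^L(\vec x)=\int_0^{\|\vec x\|_\infty}f(V_+^t(\vec x),V_-^t(\vec x))dt$, $\mathcal{D}_\mathcal{A}=\{\vec x\in\mathbb{R}^V:(V_+^t(\vec x),V_-^t(\vec x))\in\mathcal{A}\ \forall t\ge0\}$. (iii) $k$-way: $\mathcal{A}\subset\mathcal{P}(V)^k$, for $\vec x=(\vec x^1,\dots,\vec x^k)\in\mathbb{R}^{kN}$, $f^L(\vec x)=\int_{\min\vec x}^{\max\vec x}f(V^t(\vec x^1),\dots,V^t(\vec x^k))dt+f(V,\dots,V)\min\vec x$ (min and max over all entries), $\mathcal{D}_\mathcal{A}=\{\vec x\in\mathbb{R}^{kN}_{\ge0}:(V^t(\vec x^1),\dots,V^t(\vec x^k))\in\mathcal{A}\ \forall t\in\mathbb{R}\}$.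
   Formalization: Assumes the empty object (and, for types i and iii, the full object) lies in A and f_i(empty)=0; for disjoint pairs, D' is either unrestricted in sign, or nonnegative with the minimum taken only over pairs (A, empty). The literal claim is false without these. *)

(* Defs.v *)
From HB Require Import structures.
From mathcomp Require Import all_boot all_order all_algebra.
From mathcomp Require Import all_classical all_reals all_analysis.

Set Implicit Arguments.
Unset Strict Implicit.
Unset Printing Implicit Defensive.

Import Order.TTheory GRing.Theory Num.Theory.
Import numFieldNormedType.Exports.

Local Open Scope classical_set_scope.
Local Open Scope ring_scope.

(* The ground set V is 'I_N.+1, so that it is nonempty and minima of coordinates
   make sense; likewise the number of components of a k-way object is k.+1.
   Functions on a family of set objects are represented by total functions on
   all set objects; on points of the feasible domain, the extensions below only
   use values on the family. *)

Section Original.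
Context {R : realType} {N : nat}.
Implicit Types (x : 'rV[R]_N.+1) (t : R).

Definition vmin x : R := \big[Num.min/x ord0 ord0]_(i < N.+1) x ord0 i.
Definition vmax x : R := \big[Num.max/x ord0 ord0]_(i < N.+1) x ord0 i.

Definition level x t : {set 'I_N.+1} := [set i | t < x ord0 i]%SET.

Definition lovasz (f : {set 'I_N.+1} -> R) x : R :=
  \int[@lebesgue_measure R]_(t in `[vmin x, vmax x]) f (level x t)
  + f [set: 'I_N.+1]%SET * vmin x.

Definition feasible (AA : {set {set 'I_N.+1}}) : set 'rV[R]_N.+1 :=
  [set x : 'rV[R]_N.+1 | (forall i, 0 <= x ord0 i) /\ (forall t, level x t \in AA)].

End Original.

Section DisjointPair.
Context {R : realType} {N : nat}.
Implicit Types (x : 'rV[R]_N.+1) (t : R).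

Definition pair_level x t : {set 'I_N.+1} * {set 'I_N.+1} :=
  ([set i | t < x ord0 i]%SET, [set i | t < - x ord0 i]%SET).

(* `|x| is the library norm on row vectors, which is the sup norm *)
Definition pair_lovasz (f : {set 'I_N.+1} * {set 'I_N.+1} -> R) x : R :=
  \int[@lebesgue_measure R]_(t in `[0, `|x| ]) f (pair_level x t).

Definition pair_feasible (AA : {set {set 'I_N.+1} * {set 'I_N.+1}}) :
    set 'rV[R]_N.+1 :=
  [set x : 'rV[R]_N.+1 | forall t, 0 <= t -> pair_level x t \in AA].

End DisjointPair.

Section KWay.
Context {R : realType} {k N : nat}.
(* the i-th row of x is the i-th component vector *)
Implicit Types (x : 'M[R]_(k.+1, N.+1)) (t : R).

Definition kmin x : R :=
  \big[Num.min/x ord0 ord0]_(p : 'I_k.+1 * 'I_N.+1) x p.1 p.2.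
Definition kmax x : R :=
  \big[Num.max/x ord0 ord0]_(p : 'I_k.+1 * 'I_N.+1) x p.1 p.2.

Definition kway_level x t : {ffun 'I_k.+1 -> {set 'I_N.+1}} :=
  [ffun j => level (row j x) t].

Definition kway_lovasz (f : {ffun 'I_k.+1 -> {set 'I_N.+1}} -> R) x : R :=
  \int[@lebesgue_measure R]_(t in `[kmin x, kmax x]) f (kway_level x t)
  + f [ffun=> [set: 'I_N.+1]%SET] * kmin x.

Definition kway_feasible (AA : {set {ffun 'I_k.+1 -> {set 'I_N.+1}}}) :
    set 'M[R]_(k.+1, N.+1) :=
  [set x : 'M[R]_(k.+1, N.+1) | (forall j i, 0 <= x j i) /\ (forall t, kway_level x t \in AA)].

End KWay.

Section Objective.
Context {R : realType} {n : nat}.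

(* H is only meaningful on the nonnegative orthant without the origin *)
Definition orthant : set 'rV[R]_n :=
  [set a : 'rV[R]_n | (forall i, 0 <= a ord0 i) /\ a != 0].

Definition Dom (H : 'rV[R]_n -> \bar R) : set 'rV[R]_n :=
  [set a | orthant a /\ H a \is a fin_num].

Definition values {X : Type} (g : 'I_n -> X -> R) (x : X) : 'rV[R]_n :=
  \row_i g i x.

Definition admissible {T : finType} (H : 'rV[R]_n -> \bar R)
    (AA : {set T}) (f : 'I_n -> T -> R) : {set T} :=
  [set A in AA | `[< Dom H (values f A) >]]%SET.

Definition admissible_points {X : Type} (H : 'rV[R]_n -> \bar R)
    (D : set X) (g : 'I_n -> X -> R) : set X :=
  [set x | D x /\ Dom H (values g x)].

(* minimum over a finite family, with the convention min of nothing = +oo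
   (the same convention as for ereal_inf) *)
Definition family_min {T : finType} (H : 'rV[R]_n -> \bar R)
    (AA : {set T}) (f : 'I_n -> T -> R) : \bar R :=
  \big[Order.min/+oo%E]_(A in AA) H (values f A).

Definition points_inf {X : Type} (H : 'rV[R]_n -> \bar R)
    (D : set X) (g : 'I_n -> X -> R) : \bar R :=
  ereal_inf [set H (values g x) | x in D].

End Objective.

(* Main.v *)
Require Import Defs.
From HB Require Import structures.
From mathcomp Require Import all_boot all_order all_algebra.
From mathcomp Require Import all_classical all_reals all_analysis.
From mathcomp Require Import measurable_realfun.

Import Order.TTheory GRing.Theory Num.Theory.
Import numFieldNormedType.Exports.

Local Open Scope classical_set_scope.
Local Open Scope ring_scope.

(* On a feasible point x, the level object is a step function of t, so the
   extensions f_i^L(x) are all the same nonnegative combination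
   sum_A c_A f_i(A), where c_A is the measure of the set of t whose level
   object is A (plus min x when A is the top object).  Zero-homogeneity and
   H(a + b) >= min(H(a), H(b)) then provide an A with c_A <> 0 and
   H(f(A)) <= H(f^L(x)).  Conversely f_i^L takes the value f_i(A) at the
   indicator vector of A. *)

(** * Conic combinations and the objective *)

(** Induction on the sum: zero terms are dropped, and otherwise the inequality for [H (a + b)]
    bounds [H] at the sum below by its value at the head or at the tail. Homogeneity then removes
    the coefficient. Signs of [v i] are assumed only where [c i != 0], since the [f i] are
    controlled only on the family. *)
Lemma cone_min (R : realType) (n : nat) (H : 'rV[R]_n -> \bar R)
    (H_hom : forall (t : R) a, 0 < t -> orthant a -> H (t *: a) = H a)
    (H_min : forall a b, orthant a -> orthant b ->
      (Order.min (H a) (H b) <= H (a + b)%R)%E)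
    (I : Type) (s : seq I) (c : I -> R) (v : I -> 'rV[R]_n)
    (c_ge0 : forall i, 0 <= c i)
    (v_ge0 : forall i, c i != 0 -> forall j, 0 <= v i ord0 j) :
  \sum_(i <- s) c i *: v i != 0 ->
  exists i, [/\ c i != 0, orthant (v i)
    & (H (v i) <= H (\sum_(i <- s) c i *: v i)%R)%E].
Proof.
elim: s => [|i s IHs]; first by rewrite big_nil eqxx.
rewrite big_cons; set S := \sum_(i <- s) _ in IHs *.
have [ci0|ci0] := eqVneq (c i) 0; first by rewrite ci0 scale0r add0r.
have [vi0|vi0] := eqVneq (v i) 0; first by rewrite vi0 scaler0 add0r.
have ci_gt0 : 0 < c i by rewrite lt0r ci0 c_ge0.
have vi_orthant : orthant (v i) by split=> // j; exact: v_ge0.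
have [S0 _|S0 _] := eqVneq S 0.
  by exists i; split=> //; rewrite S0 addr0 H_hom.
have civi_orthant : orthant (c i *: v i).
  split=> [j|]; last by rewrite scaler_eq0 negb_or ci0.
  by rewrite mxE mulr_ge0 ?v_ge0.
have S_orthant : orthant S.
  split=> // j; rewrite summxE sumr_ge0// => a _; rewrite mxE.
  by have [->|ca0] := eqVneq (c a) 0; rewrite ?mul0r// mulr_ge0 ?v_ge0.
have := H_min _ _ civi_orthant S_orthant; rewrite H_hom// ge_min => /orP[le|le].
  by exists i.
have [a [ca va Ha]] := IHs S0.
by exists a; split=> //; exact: le_trans le.
Qed.

(** Common core of the three types. The coefficients [c] depend on [x] but not on [i], so the scalar
    identities combine into one identity between value vectors, to which [cone_min] applies. *)
Lemma family_min_points_inf (R : realType) (n : nat) (H : 'rV[R]_n -> \bar R)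
    (H_gtNy : forall a, orthant a -> H a != -oo%E)
    (H_hom : forall (t : R) a, 0 < t -> orthant a -> H (t *: a) = H a)
    (H_min : forall a b, orthant a -> orthant b ->
      (Order.min (H a) (H b) <= H (a + b)%R)%E)
    (T : finType) (X : Type) (AA : {set T}) (D : set X)
    (f : 'I_n -> T -> R) (g : 'I_n -> X -> R)
    (f_ge0 : forall i A, A \in AA -> 0 <= f i A)
    (g_cone : forall x, D x -> exists c : T -> R,
      [/\ forall A, 0 <= c A, forall A, c A != 0 -> A \in AA
        & forall i, g i x = \sum_A c A * f i A])
    (f_sub_g : forall A, A \in AA -> values f A != 0 ->
      exists2 x, D x & forall i, g i x = f i A) :
  family_min H (admissible H AA f) f =
  points_inf H (admissible_points H D g) g.
Proof.
apply/eqP; rewrite eq_le; apply/andP; split.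
- apply: le_ereal_inf_tmp => _ [x [Dx [[_ gx_neq0] Hgx]] <-].
  have [c [c_ge0 cAA gE]] := g_cone x Dx.
  have gxE : values g x = \sum_A c A *: values f A.
    by apply/rowP => i; rewrite mxE gE summxE;
    apply: eq_bigr => A _; rewrite !mxE.
  have [||A [cA fA HA]] := @cone_min _ _ _ H_hom H_min _ (index_enum T) c
    (values f) c_ge0 _ _.
  + by move=> A cA i; rewrite mxE f_ge0// cAA.
  + by rewrite -gxE.
  rewrite -gxE in HA; apply: (@bigmin_inf _ _ _ _ A) => //.
  (* [A] is admissible: [H] is never [-oo] on the orthant, and here it is at most its finite value
     at [x]. *)
  rewrite inE cAA//=; apply/asboolP; split=> //.
  rewrite fin_numE H_gtNy//= -ltey (le_lt_trans HA)// ltey.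
  by move: Hgx; rewrite fin_numE => /andP[].
- apply/bigmin_geP; split; first exact: leey.
  move=> A; rewrite inE => /andP[AAA /asboolP fA].
  have [x Dx gx] := f_sub_g A AAA fA.1.2.
  have gxE : values g x = values f A by apply/rowP => i; rewrite !mxE gx.
  by apply: ereal_inf_lbound; exists x => //; [split=> //|]; rewrite gxE.
Qed.

(** * Integrals of functions with finitely many levels *)

Section StepFunctions.
Context d (X : measurableType d) (R : realType).
Context (mu : {measure set X -> \bar R}) (D : set X).
Context (T : finType) (lev : X -> T) (f : T -> R).
Hypothesis mD : measurable D.
Hypothesis muD : (mu D < +oo)%E.
Hypothesis mlev : forall A, measurable [set t | lev t = A].

Let fiber A := [set t | lev t = A].

Let step_indic t :
  (f (lev t))%:E = (\sum_A (f A)%:E * (\1_(fiber A) t)%:E)%E.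
Proof.
rewrite (bigD1 (lev t))//= indicE mem_set// mule1 big1 ?adde0// => A neqA.
by rewrite indicE memNset ?mule0//= => eqA; rewrite eqA eqxx in neqA.
Qed.

Let fin_num_fiber A : mu (fiber A `&` D) \is a fin_num.
Proof.
rewrite ge0_fin_numE// (le_lt_trans _ muD)//.
apply: le_measure; rewrite ?inE; [|exact: mD|by move=> t []].
by apply: measurableI; first exact: mlev.
Qed.

Let integrable_fiber A : mu.-integrable D (fun t => (\1_(fiber A) t)%:E).
Proof.
apply/integrableP; split.
  by apply/measurable_EFinP; apply: measurable_indic; exact: mlev.
under eq_integral do rewrite gee0_abs ?lee_fin//.
rewrite integral_indic; [|exact: mD|exact: mlev].
by rewrite -ge0_fin_numE.
Qed.

(** A function factoring through a finite type is a finite combination of indicators of fibers, each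
    meeting [D] in finite measure. *)
Lemma integrable_step : mu.-integrable D (EFin \o (f \o lev)).
Proof.
rewrite (_ : _ \o _ = fun t => (\sum_A (f A)%:E * (\1_(fiber A) t)%:E)%E).
  by apply: integrable_sum => // A _; exact: integrableZl.
by apply/funext => t; rewrite -step_indic.
Qed.

Lemma Rintegral_step :
  \int[mu]_(t in D) f (lev t) =
  \sum_A fine (mu ([set t | lev t = A] `&` D)) * f A.
Proof.
rewrite /Rintegral; under eq_integral do rewrite step_indic.
rewrite integral_sum//; last by move=> A; exact: integrableZl.
have intE A : (\int[mu]_(t in D) ((f A)%:E * (\1_(fiber A) t)%:E) =
    (f A)%:E * mu (fiber A `&` D))%E.
  by rewrite integralZl// integral_indic//; exact: mlev.
under eq_bigr do rewrite intE.
rewrite -sum_fine => [|A _]; last exact: fin_numM.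
by apply: eq_bigr => A _; rewrite fineM//= mulrC.
Qed.

End StepFunctions.

(** * Measurability of the fibers of the level maps *)

Section Levels.
Context {R : realType} {k N : nat}.

Lemma measurable_level (x : 'rV[R]_N.+1) A : measurable [set t | level x t = A].
Proof.
(* Each coordinate puts one condition on [t]: an open left ray if [i \in A], a closed right ray
   otherwise. *)
rewrite (_ : [set t | _] =
    \bigcap_(i in setT) [set t | (t < x ord0 i) = (i \in A)]).
  apply: fin_bigcap_measurable => // i _; case: (i \in A).
    by rewrite -[X in measurable X]set_itvNyo.
  rewrite (_ : [set t | _] = `[x ord0 i, +oo[%classic)//.
  by apply/seteqP; split=> t /=; rewrite in_itv/= andbT leNgt;
    [move=> ->|move/negbTE].
apply/seteqP; split=> t /=; first by move=> <- i _; rewrite /= inE.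
by move=> xtA; apply/setP => i; rewrite inE; exact: xtA.
Qed.

Lemma measurable_pair_level (x : 'rV[R]_N.+1) A :
  measurable [set t | pair_level x t = A].
Proof.
rewrite (_ : [set t | _] =
    [set t | level x t = A.1] `&` [set t | level (- x) t = A.2]).
  by apply: measurableI; exact: measurable_level.
have levN t : level (- x) t = [set i | t < - x ord0 i]%SET.
  by apply/setP => i; rewrite !inE mxE.
apply/seteqP; split=> t /=; rewrite levN; first by move=> <-.
by case: A => A B /= [<- <-].
Qed.

Lemma measurable_kway_level (x : 'M[R]_(k.+1, N.+1)) A :
  measurable [set t | kway_level x t = A].
Proof.
rewrite (_ : [set t | _] =
    \bigcap_(j in setT) [set t | level (row j x) t = A j]).
  by apply: fin_bigcap_measurable => // j _; exact: measurable_level.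
apply/seteqP; split=> t /=; first by move=> <- j _; rewrite /= ffunE.
by move=> xtA; apply/ffunP => j; rewrite ffunE; exact: xtA.
Qed.

End Levels.

(** * Extensions as conic combinations, and their values at indicators *)

Section Extension.
Context {R : realType} {T : finType} (lev : R -> T).
Hypothesis mlev : forall A, measurable [set t | lev t = A].

Let itv_lty (a b : R) : (@lebesgue_measure R `[a, b] < +oo)%E.
Proof. by rewrite lebesgue_measure_itv; case: ifP => _; rewrite ?ltry. Qed.

(** A fiber of nonzero measure is nonempty. The bounds on [t] are recorded because [pair_feasible]
    constrains only levels with [0 <= t]. *)
Lemma integral_cone (a b : R) : exists c : T -> R,
  [/\ forall A, 0 <= c A,
      forall A, c A != 0 -> exists2 t, a <= t <= b & lev t = A
    & forall f : T -> R,
        \int[@lebesgue_measure R]_(t in `[a, b]) f (lev t) = \sum_A c A * f A].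
Proof.
exists (fun A => fine (@lebesgue_measure R ([set t | lev t = A] `&` `[a, b]))).
split=> [A|A|f]; first exact: fine_ge0.
  apply: contraNP => /forall2NP noA; apply/eqP.
  rewrite (_ : _ `&` _ = set0) ?measure0//; apply/seteqP; split=> t //= [tA].
  by rewrite in_itv/= => tab; case: (noA t).
by apply: Rintegral_step => //; exact: itv_lty.
Qed.

(** The boundary term adds [m] to the coefficient of [top], which is therefore listed beside the
    attained levels. *)
Lemma lovasz_cone (a b m : R) (top : T) : 0 <= m -> exists c : T -> R,
  [/\ forall A, 0 <= c A,
      forall A, c A != 0 -> A = top \/ exists t, lev t = A
    & forall f : T -> R,
        \int[@lebesgue_measure R]_(t in `[a, b]) f (lev t) + f top * m =
        \sum_A c A * f A].
Proof.
move=> m_ge0; have [c [c_ge0 cP cE]] := integral_cone a b.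
exists (fun A => c A + (A == top)%:R * m); split=> [A|A|f].
- by rewrite addr_ge0 ?mulr_ge0.
- have [->|_] := eqVneq A top; first by left.
  by rewrite mul0r addr0 => /cP[t _ tA]; right; exists t.
- under eq_bigr do rewrite mulrDl; rewrite big_split/= cE; congr (_ + _).
  rewrite (bigD1 top)//= eqxx mul1r big1 ?addr0 1?mulrC// => A /negbTE ->.
  by rewrite !mul0r.
Qed.

Lemma integral_unit_step (f : T -> R) A :
  (forall t, 0 <= t -> t < 1 -> lev t = A) ->
  \int[@lebesgue_measure R]_(t in `[0, 1]) f (lev t) = f A.
Proof.
move=> levA.
have mu01 : @lebesgue_measure R `[0, 1[ = 1%:E.
  by rewrite lebesgue_measure_itv/= lte_fin ltr01 oppr0 adde0.
(* Levels are strict, so an indicator has an empty level at [t = 1]; this endpoint is removed as a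
   null set, at the price of an integrability goal. *)
rewrite -Rintegral_itv_bndo_bndc.
  rewrite (@eq_Rintegral _ _ _ _ _ (cst (f A))) => [|t].
    rewrite Rintegral_cst//.
    rewrite [X in fine X](_ : _ = 1%:E) ?mulr1//; exact: mu01.
  by rewrite inE/= in_itv/= => /andP[t0 t1]; rewrite levA.
have mu01_lty : (@lebesgue_measure R `[0%R, 1%R[ < +oo)%E by rewrite mu01 ltry.
exact: (@integrable_step _ _ R lebesgue_measure `[0, 1[ _ lev f
  (measurable_itv _) mu01_lty mlev).
Qed.

(* When [full] holds, the integration interval is the single point 1 and the
   whole value comes from the boundary term. *)
Lemma lovasz_indicator (f : T -> R) A (top : T) (full : bool) :
  (full -> A = top) -> (forall t, 0 <= t -> t < 1 -> lev t = A) ->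
  \int[@lebesgue_measure R]_(t in `[full%:R, 1]) f (lev t) + f top * full%:R
  = f A.
Proof.
case: full => /= [->// _|_ levA].
  by rewrite set_itv1 Rintegral_set1 add0r mulr1.
by rewrite mulr0 addr0 (integral_unit_step f A).
Qed.

End Extension.

(** * Minimum and maximum of 0-1 families *)

Section ExtremaOfIndicators.
Context {R : realType} {J : finType} (j0 : J) (P : pred J).

(** The default value is the term at [j0], as in [vmin] and [kmin], so it leaves the extremum
    unchanged. *)
Lemma bigmin_indicator :
  \big[Num.min/(P j0)%:R]_j (P j)%:R = [forall j, P j]%:R :> R.
Proof.
apply/eqP; rewrite eq_le; apply/andP; split.
  have [/forallP allP|/forallPn[j /negbTE Pj]] := boolP [forall j, P j].
    by apply: (@bigmin_inf _ _ _ _ j0) => //; rewrite allP.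
  by apply: (@bigmin_inf _ _ _ _ j) => //; rewrite Pj.
apply/bigmin_geP; case: forallP => [allP|_]; last first.
  by split=> [|j _]; rewrite ler0n.
by split=> [|j _]; rewrite allP.
Qed.

Lemma bigmax_indicator :
  \big[Num.max/(P j0)%:R]_j (P j)%:R = [exists j, P j]%:R :> R.
Proof.
apply/eqP; rewrite eq_le; apply/andP; split.
  apply/bigmax_leP; case: existsP => [_|noP].
    by split=> [|j _]; rewrite lern1 leq_b1.
  split=> [|j _]; rewrite ler_nat leqn0 eqb0; apply/negP => Pj;
    by case: noP; eexists; exact: Pj.
have [/existsP[j Pj]|_] := boolP [exists j, P j].
  by apply: (@bigmax_sup _ _ _ _ j) => //; rewrite Pj.
by apply: (@bigmax_sup _ _ _ _ j0) => //; rewrite ler0n.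
Qed.

End ExtremaOfIndicators.

(** * Indicator vectors of the three kinds of set objects *)

Section Indicators.
Context {R : realType} {k N : nat}.

Definition indic_row (A : {set 'I_N.+1}) : 'rV[R]_N.+1 := \row_i (i \in A)%:R.

(** The two outer ranges of [t] are where feasibility of the indicator uses that the full and empty
    sets lie in the family. *)
Lemma level_indic_row A t : level (indic_row A) t =
  if t < 0 then [set: 'I_N.+1]%SET else if t < 1 then A else finset.set0.
Proof.
apply/setP => i; rewrite inE mxE; have [t0|t0] := ltP t 0.
  by rewrite inE (lt_le_trans t0)// ler0n.
by case: ifP => t1; rewrite ?inE; case: (i \in A); rewrite /= ?t1// ltNge t0.
Qed.

Lemma lovasz_indic_row f A : A != finset.set0 -> lovasz f (indic_row A) = f A.
Proof.
move=> A_neq0; rewrite /lovasz /vmin /vmax.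
under eq_bigr do rewrite mxE.
under [X in `[_, X]%classic]eq_bigr do rewrite mxE.
rewrite !mxE bigmin_indicator bigmax_indicator.
(* Since [A] is nonempty the maximum is 1; the minimum is the truth value of [A] being full. *)
rewrite (introT existsP (set0Pn _ A_neq0)).
apply: (@lovasz_indicator _ _ (level (indic_row A)))
  => [B|/forallP Afull|t t0 t1].
- exact: measurable_level.
- by apply/setP => i; rewrite inE; exact: Afull.
- by rewrite level_indic_row ltNge t0 t1.
Qed.

Definition indic_mx (A : {ffun 'I_k.+1 -> {set 'I_N.+1}}) : 'M[R]_(k.+1, N.+1) :=
  \matrix_(j, i) (i \in A j)%:R.

Lemma kway_level_indic_mx A t : kway_level (indic_mx A) t =
  if t < 0 then [ffun=> [set: 'I_N.+1]%SET]
  else if t < 1 then A else [ffun=> finset.set0].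
Proof.
apply/ffunP => j; rewrite ffunE.
have -> : row j (indic_mx A) = indic_row (A j) by apply/rowP => i; rewrite !mxE.
by rewrite level_indic_row; case: ifP => _; [|case: ifP => _]; rewrite ?ffunE.
Qed.

Lemma kway_lovasz_indic_mx f A : A != [ffun=> finset.set0] ->
  kway_lovasz f (indic_mx A) = f A.
Proof.
move=> A_neq0; rewrite /kway_lovasz /kmin /kmax.
under eq_bigr do rewrite mxE.
under [X in `[_, X]%classic]eq_bigr do rewrite mxE.
rewrite !mxE (bigmin_indicator (ord0, ord0) (fun p => p.2 \in A p.1)).
rewrite (bigmax_indicator (ord0, ord0) (fun p => p.2 \in A p.1)).
(* The maximum is 1: otherwise every component of [A] would be empty. *)
have -> : [exists p : 'I_k.+1 * 'I_N.+1, p.2 \in A p.1].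
  apply: contraNT A_neq0 => /existsPn A0; apply/eqP/ffunP => j; rewrite ffunE.
  by apply/setP => i; rewrite inE; apply/negbTE; exact: (A0 (j, i)).
apply: (@lovasz_indicator _ _ (kway_level (indic_mx A)))
  => [B|/forallP Afull|t t0 t1].
- exact: measurable_kway_level.
- by apply/ffunP => j; apply/setP => i; rewrite ffunE inE; exact: (Afull (j, i)).
- by rewrite kway_level_indic_mx ltNge t0 t1.
Qed.

Definition indic_pair (A : {set 'I_N.+1} * {set 'I_N.+1}) : 'rV[R]_N.+1 :=
  \row_i ((i \in A.1)%:R - (i \in A.2)%:R).

Lemma pair_level_indic_pair A t : (A.1 :&: A.2)%SET = finset.set0 -> 0 <= t ->
  pair_level (indic_pair A) t =
  if t < 1 then A else (finset.set0, finset.set0).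
Proof.
case: A => A B /= AB0 t0.
have tN1 : (t < -1) = false.
  by apply/negbTE; rewrite -leNgt (le_trans _ t0)// lerN10.
have t_lt0 : (t < 0) = false by apply/negbTE; rewrite -leNgt.
have AB i : (i \in A) && (i \in B) = false by rewrite -finset.in_setI AB0 inE.
(* Disjointness prevents cancellation: every coordinate is 1, -1 or 0. *)
by case: ifP => t1; congr pair; apply/setP => i; rewrite !inE mxE/=;
  move: (AB i); case: (i \in A); case: (i \in B) => //= _;
  rewrite ?subr0 ?sub0r ?opprK ?oppr0.
Qed.

(** By disjointness the absolute values of the entries form the indicator of the union, which is
    nonempty. *)
Lemma norm_indic_pair A : (A.1 :&: A.2)%SET = finset.set0 ->
  A != (finset.set0, finset.set0) -> `|indic_pair A| = 1.
Proof.
case: A => A B /= AB0 AB_neq0.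
have AB i : (i \in A) && (i \in B) = false by rewrite -finset.in_setI AB0 inE.
have normE i j : `|indic_pair (A, B) i j| = ((j \in A) || (j \in B))%:R.
  rewrite mxE/=; move: (AB j); case: (j \in A); case: (j \in B) => //= _;
  by rewrite ?subr0 ?sub0r ?normrN ?normr1 ?normr0.
rewrite /Num.norm/= mx_normrE; under eq_bigr do rewrite normE.
apply/eqP; rewrite eq_le; apply/andP; split.
  by apply: bigmax_le => // p _; rewrite lern1 leq_b1.
have [i ABi] : exists i, (i \in A) || (i \in B).
  have [A0|[i iA]] := set_0Vmem A; last by exists i; rewrite iA.
  have [B0|[i iB]] := set_0Vmem B; last by exists i; rewrite iB orbT.
  by rewrite A0 B0 eqxx in AB_neq0.
by apply: (@bigmax_sup _ _ _ _ (ord0, i)) => //=; rewrite ABi.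
Qed.

Lemma pair_lovasz_indic_pair f A : (A.1 :&: A.2)%SET = finset.set0 ->
  A != (finset.set0, finset.set0) -> pair_lovasz f (indic_pair A) = f A.
Proof.
move=> A_disj A_neq0; rewrite /pair_lovasz norm_indic_pair//.
apply: integral_unit_step => [B|t t0 t1]; first exact: measurable_pair_level.
by rewrite pair_level_indic_pair// t1.
Qed.

End Indicators.

(** * Assembly for the three types *)

(** Used to exclude the empty object, where all [f i] vanish, before evaluating an extension at an
    indicator. *)
Lemma values_neq0 {R : realType} {n : nat} {X : eqType} {f : 'I_n -> X -> R}
    {x0 x : X} :
  (forall i, f i x0 = 0) -> values f x != 0 -> x != x0.
Proof.
move=> f0; apply: contra_neq => ->.
by apply/rowP => i; rewrite !mxE.
Qed.

Theorem theorem3p2 (R : realType) (n N k : nat) (H : 'rV[R]_n -> \bar R)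
  (H_gtNy : forall a, orthant a -> H a != -oo%E)
  (H_hom : forall (t : R) a, 0 < t -> orthant a -> H (t *: a) = H a)
  (H_min : forall a b, orthant a -> orthant b ->
     (Order.min (H a) (H b) <= H (a + b)%R)%E) :
  (* original extension *)
  (forall (AA : {set {set 'I_N.+1}}) (f : 'I_n -> {set 'I_N.+1} -> R),
     finset.set0 \in AA -> [set: 'I_N.+1]%SET \in AA ->
     (forall i A, A \in AA -> 0 <= f i A) ->
     (forall i, f i finset.set0 = 0) ->
     let fL := fun i => lovasz (f i) in
     family_min H (admissible H AA f) f =
     points_inf H (admissible_points H (feasible AA) fL) fL) /\
  (* disjoint-pair extension *)
  (forall (AA : {set {set 'I_N.+1} * {set 'I_N.+1}})
          (f : 'I_n -> {set 'I_N.+1} * {set 'I_N.+1} -> R),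
     (forall p, p \in AA -> (p.1 :&: p.2)%SET = finset.set0) ->
     (finset.set0, finset.set0) \in AA ->
     (forall i p, p \in AA -> 0 <= f i p) ->
     (forall i, f i (finset.set0, finset.set0) = 0) ->
     let fL := fun i => pair_lovasz (f i) in
     family_min H (admissible H AA f) f =
     points_inf H (admissible_points H (pair_feasible AA) fL) fL /\
     (* nonnegative vectors see exactly the pairs (A, set0) *)
     family_min H [set p in admissible H AA f | p.2 == finset.set0]%SET f =
     points_inf H (admissible_points H
       (pair_feasible AA `&` [set x : 'rV[R]_N.+1 | forall i, 0 <= x ord0 i]) fL) fL) /\
  (* k-way extension *)
  (forall (AA : {set {ffun 'I_k.+1 -> {set 'I_N.+1}}})
          (f : 'I_n -> {ffun 'I_k.+1 -> {set 'I_N.+1}} -> R),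
     [ffun=> finset.set0] \in AA -> [ffun=> [set: 'I_N.+1]%SET] \in AA ->
     (forall i A, A \in AA -> 0 <= f i A) ->
     (forall i, f i [ffun=> finset.set0] = 0) ->
     let fL := fun i => kway_lovasz (f i) in
     family_min H (admissible H AA f) f =
     points_inf H (admissible_points H (kway_feasible AA) fL) fL).
Proof.

split; last split.
- move=> AA f AA0 AAT f_ge0 f0 fL.
  apply: family_min_points_inf => // [x [x_ge0 xAA]|A AAA fA].
    have vmin_ge0 : 0 <= vmin x by apply/bigmin_geP; split=> [|i _]; exact: x_ge0.
    have [c [c_ge0 cAA cE]] := lovasz_cone _ (measurable_level x)
      (vmin x) (vmax x) _ [set: 'I_N.+1]%SET vmin_ge0.
    exists c; split=> // [A /cAA[->//|[t <-]]|i]; first exact: xAA.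
    exact: cE.
  exists (indic_row A) => [|i].
    split=> [i|t]; first by rewrite mxE ler0n.
    by rewrite level_indic_row; case: ifP => // _; case: ifP.
  by apply: lovasz_indic_row; exact: (values_neq0 f0 fA).
- move=> AA f AAdisj AA0 f_ge0 f0 fL.
  (* [cone] and [indic] serve both the full domain and its nonnegative part. *)
  have cone x : pair_feasible AA x -> exists c : _ -> R,
    [/\ forall A, 0 <= c A,
        forall A, c A != 0 -> exists2 t, 0 <= t & pair_level x t = A
      & forall i, fL i x = \sum_A c A * f i A].
    move=> xAA; have [c [c_ge0 cAA cE]] :=
      integral_cone _ (measurable_pair_level x) 0 `|x|.
    exists c; split=> // [A /cAA[t /andP[t0 _] tA]|i]; last exact: cE.
    by exists t.
  have indic A : A \in AA -> values f A != 0 ->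
      pair_feasible AA (indic_pair A : 'rV[R]_N.+1) /\
      forall i, fL i (indic_pair A) = f i A.
    move=> AAA /(values_neq0 f0) A_neq0; split=> [t t0|i].
      by rewrite pair_level_indic_pair ?AAdisj//; case: ifP.
    by apply: pair_lovasz_indic_pair => //; exact: AAdisj.
  split.
    apply: family_min_points_inf => // [x xAA|A AAA fA].
      have [c [c_ge0 cP cE]] := cone x xAA.
      by exists c; split=> // A /cP[t t0 <-]; exact: xAA.
    by have [] := indic A AAA fA; exists (indic_pair A).
  (* The condition on [p.2] moves into the family, so the common core applies to the subfamily of
     pairs with empty second set. *)
  rewrite (_ : [set p in _ | _]%SET =
    admissible H [set p in AA | p.2 == finset.set0]%SET f); last first.
    by apply/setP => p; rewrite !inE andbAC.
  apply: family_min_points_inf => // [i A|x [xAA x_ge0]|A].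
  + by rewrite inE => /andP[AAA _]; exact: f_ge0.
  + have [c [c_ge0 cP cE]] := cone x xAA.
    exists c; split=> // A /cP[t t0 <-]; rewrite inE xAA//=.
    (* For [x] nonnegative and [0 <= t], no coordinate satisfies [t < - x ord0 i]. *)
    by apply/eqP/setP => i; rewrite !inE ltNge (le_trans _ t0)// oppr_le0.
  + rewrite inE => /andP[AAA /eqP A2] fA; have [xAA xE] := indic A AAA fA.
    exists (indic_pair A) => //; split=> // i.
    by rewrite mxE A2 inE subr0 ler0n.
- move=> AA f AA0 AAT f_ge0 f0 fL.
  apply: family_min_points_inf => // [x [x_ge0 xAA]|A AAA fA].
    have kmin_ge0 : 0 <= kmin x by apply/bigmin_geP; split=> [|p _]; exact: x_ge0.
    have [c [c_ge0 cAA cE]] := lovasz_cone _ (measurable_kway_level x)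
      (kmin x) (kmax x) _ [ffun=> [set: 'I_N.+1]%SET] kmin_ge0.
    exists c; split=> // [A /cAA[->//|[t <-]]|i]; first exact: xAA.
    exact: cE.
  exists (indic_mx A) => [|i].
    split=> [j i|t]; first by rewrite mxE ler0n.
    by rewrite kway_level_indic_mx; case: ifP => // _; case: ifP.
  by apply: kway_lovasz_indic_mx; exact: (values_neq0 f0 fA).
Qed.
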